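(* Let $E\subseteq\mathbb{R}^d$. Then $E$ is disperse if and only if $0\in\mathrm{ri}(\mathrm{co}(E))$.
   Context: A set $E\subseteq\mathbb{R}^d$ is called disperse if for each $h\in\mathbb{R}^d$: either $h\cdot y=0$ for all $y\in E$, or both $\inf_{y\in E}h\cdot y<0$ and $\sup_{y\in E}h\cdot y>0$. Here $\cdot$ is the Euclidean inner product, $\mathrm{co}(E)$ is the convex hull of $E$ (the smallest convex set containing $E$), and, for a convex set $C\subseteq\mathbb{R}^d$, $\mathrm{ri}(C)=\{x\in C: B(x,r)\cap\mathrm{aff}\,C\subseteq C\text{ for some }r>0\}$ is its relative interior, i.e. its interior relative to its affine hull $\mathrm{aff}\,C$, where $B(x,r)$ is the ball of radius $r$ centred at $x$.
   Formalization: E is assumed nonempty: the empty set is vacuously disperse, but its convex hull is empty, so 0 is not in the relative interior and the equivalence as stated fails for E = ∅. *)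

(* Defs.v *)
From mathcomp Require Import all_boot all_order all_algebra.
From mathcomp Require Import classical_sets reals ereal convex.

Set Implicit Arguments.
Unset Strict Implicit.
Unset Printing Implicit Defensive.

Import Order.TTheory GRing.Theory Num.Theory.

Local Open Scope classical_set_scope.
Local Open Scope ring_scope.

Definition dotp (R : realType) (d : nat) (x y : 'rV[R]_d) : R :=
  \sum_(i < d) x 0 i * y 0 i.

(* Infimum and supremum are taken in the extended reals, since h . y need not
   be bounded on E.  The empty set is disperse (vacuously), although 0 is not
   in the relative interior of its convex hull. *)
Definition disperse (R : realType) (d : nat) (E : set 'rV[R]_d) : Prop :=
  forall h : 'rV[R]_d,
    (forall y, E y -> dotp h y = 0) \/
    (ereal_inf [set (dotp h y)%:E | y in E] < 0)%E /\
    (0 < ereal_sup [set (dotp h y)%:E | y in E])%E.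

Definition convex_hull (R : realType) (d : nat) (E : set 'rV[R]_d) :
    set 'rV[R]_d :=
  smallest (@convex_set R 'rV[R]_d) E.

Definition affine_set (R : realType) (d : nat) (A : set 'rV[R]_d) : Prop :=
  forall (x y : 'rV[R]_d) (t : R), A x -> A y -> A (t *: x + (1 - t) *: y).

Definition affine_hull (R : realType) (d : nat) (E : set 'rV[R]_d) :
    set 'rV[R]_d :=
  smallest (@affine_set R d) E.

(* The library's ball on row vectors is that of the sup norm. *)
Definition eucl_ball (R : realType) (d : nat) (x : 'rV[R]_d) (r : R) :
    set 'rV[R]_d :=
  [set y | Num.sqrt (dotp (y - x) (y - x)) < r].

Definition relint (R : realType) (d : nat) (C : set 'rV[R]_d) :
    set 'rV[R]_d :=
  [set x | C x /\
    exists2 r : R, 0 < r & eucl_ball x r `&` affine_hull C `<=` C].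

(* Main.v *)
(* The direction from dispersal rests on M. Riesz's extension theorem applied to
   the cone K generated by co(E).  Pick a_1, ..., a_m in E spanning span(E); then
   s = a_1 + ... + a_m is an order unit for K in span(E).  If -s were not in K,
   the functional t s |-> t would be nonnegative on K, and extending it one
   dimension at a time would give an h that is nonnegative on E without vanishing
   there.  So -s lies in K, hence K = span(E), and this forces co(E) to contain 0
   together with a neighbourhood of 0 in span(E). *)
Require Import Defs.
From mathcomp Require Import all_boot all_order all_algebra.
From mathcomp Require Import classical_sets reals ereal convex.
From mathcomp Require Import boolp interval_inference ring.

Set Implicit Arguments.
Unset Strict Implicit.
Unset Printing Implicit Defensive.

Import Order.TTheory GRing.Theory Num.Theory.

Local Open Scope classical_set_scope.
Local Open Scope ring_scope.

(** * The dot product: bilinearity, coordinate bounds, separation from a subspace *)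

Section DotProduct.
Context (R : realType) (d : nat).
Implicit Types (x y z : 'rV[R]_d) (a : R).

Lemma dotpC x y : dotp x y = dotp y x.
Proof. by apply: eq_bigr => i _; rewrite mulrC. Qed.

Lemma dotpDr x y z : dotp x (y + z) = dotp x y + dotp x z.
Proof. by rewrite -big_split; apply: eq_bigr => i _; rewrite mxE mulrDr. Qed.

Lemma dotpZr a x y : dotp x (a *: y) = a * dotp x y.
Proof. by rewrite big_distrr; apply: eq_bigr => i _; rewrite mxE mulrCA. Qed.

Lemma dotpDl x y z : dotp (x + y) z = dotp x z + dotp y z.
Proof. by rewrite dotpC dotpDr !(dotpC z). Qed.

Lemma dotpZl a x y : dotp (a *: x) y = a * dotp x y.
Proof. by rewrite dotpC dotpZr dotpC. Qed.

Lemma dotpNl x y : dotp (- x) y = - dotp x y.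
Proof. by rewrite -scaleN1r dotpZl mulN1r. Qed.

Lemma sqr_coord_le_dotp x i : x 0 i ^+ 2 <= dotp x x.
Proof.
rewrite /dotp (bigD1 i) //= -expr2 lerDl sumr_ge0 // => j _.
by rewrite -expr2 sqr_ge0.
Qed.

Lemma dotp_eq0 x : dotp x x = 0 -> x = 0.
Proof.
move=> x0; apply/rowP => i; rewrite mxE; apply/eqP; rewrite -sqrf_eq0 eq_le.
by rewrite sqr_ge0 -x0 sqr_coord_le_dotp.
Qed.

Lemma coord_le_norm x i : `|x 0 i| <= Num.sqrt (dotp x x).
Proof. by rewrite -sqrtr_sqr ler_wsqrtr // sqr_coord_le_dotp. Qed.

Lemma norm_dotpZ a x : Num.sqrt (dotp (a *: x) (a *: x)) =
  `|a| * Num.sqrt (dotp x x).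
Proof.
by rewrite dotpZl dotpZr mulrA -expr2 sqrtrM ?sqr_ge0 // sqrtr_sqr.
Qed.

(* A row vector outside a subspace is separated from it by a linear form: some
   column of the cokernel of [F]. *)
Lemma dotp_separates m (F : 'M[R]_(m, d)) (v : 'rV[R]_d) : ~~ (v <= F)%MS ->
  exists2 g, dotp g v = 1 & forall x, (x <= F)%MS -> dotp g x = 0.
Proof.
rewrite submxE => /rV0Pn [j cj]; set c := _ 0 j in cj.
pose g : 'rV_d := (col j (cokermx F))^T.
have gE x : dotp g x = (x *m cokermx F) 0 j.
  by rewrite mxE; apply: eq_bigr => i _; rewrite !mxE mulrC.
exists (c^-1 *: g) => [|x xF].
  by rewrite dotpZl gE mulVf.
by rewrite dotpZl gE; move: xF; rewrite submxE => /eqP ->; rewrite mxE mulr0.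
Qed.

End DotProduct.

(** * Riesz extension of nonnegative forms on a convex cone *)

Section Cone.
Context (R : realType) (d : nat) (K : set 'rV[R]_d).
Hypothesis coneD : forall x y, K x -> K y -> K (x + y).
Hypothesis coneZ : forall t x, 0 <= t -> K x -> K (t *: x).

Lemma cone_sum (I : finType) (F : I -> 'rV[R]_d) :
  K 0 -> (forall i, K (F i)) -> K (\sum_i F i).
Proof. by move=> K0 KF; elim/big_ind: _. Qed.

(** The value at [v] must be at least [- dotp h x] when [x] is in [F] and [x + v] in [K], and at
    most [dotp h y] when [y] is in [F] and [y - v] in [K]. Adding the two memberships shows that
    lower bounds never exceed upper bounds. The hypotheses on [s] give one bound of each kind, so
    the supremum of the lower bounds is admissible. *)
Lemma riesz_step (F : 'M[R]_d) (s v h : 'rV[R]_d) : (s <= F)%MS ->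
  (exists N, K (N *: s + v)) -> (exists N, K (N *: s - v)) ->
  (forall x, (x <= F)%MS -> K x -> 0 <= dotp h x) ->
  exists2 h', dotp h' s = dotp h s &
    forall x, (x <= F + v)%MS -> K x -> 0 <= dotp h' x.
Proof.
move=> sF [N1 K1] [N2 K2] hF.
have [vF|vF] := boolP (v <= F)%MS.
  exists h => // x xFv; apply: hF; apply: submx_trans xFv _.
  by rewrite addsmx_sub submx_refl.
have [g gv gF] := dotp_separates vF.
pose A := [set - dotp h x | x in [set x | (x <= F)%MS /\ K (x + v)]].
have Aub y : (y <= F)%MS -> K (y - v) -> ubound A (dotp h y).
  move=> yF Ky _ [x [xF Kx] <-]; rewrite -subr_ge0 opprK -dotpDr.
  apply: hF; first by rewrite addmx_sub.
  have -> : y + x = (x + v) + (y - v) by rewrite addrACA subrr addr0 addrC.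
  exact: coneD.
have A0 : A !=set0.
  exists (- dotp h (N1 *: s)); exists (N1 *: s) => //.
  by split => //; apply: scalemx_sub.
have Abnd : has_ubound A.
  by exists (dotp h (N2 *: s)); apply: Aub => //; apply: scalemx_sub.
(* As [g] vanishes on [F] and is 1 at [v], this form agrees with [h] on [F] and takes the value
   [sup A] at [v]. *)
exists (h + (sup A - dotp h v) *: g) => [|x /sub_addsmxP [[u1 u2] /= ->]].
  by rewrite dotpDl dotpZl gF // mulr0 addr0.
rewrite [u2]mx11_scalar mul_scalar_mx; move: (u2 0 0) => t {x u2}.
set y := u1 *m F; have yF : (y <= F)%MS by apply: submxMl.
move=> Kx.
have -> : dotp (h + (sup A - dotp h v) *: g) (y + t *: v) =
    dotp h y + t * sup A.
  by rewrite dotpDl dotpZl !dotpDr !dotpZr gF // gv; ring.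
(* Dividing by [|t|] puts a point of [F] minus [v] (for negative [t]) or plus [v] (for positive [t])
   in [K], so [sup A] is compared with an upper or a lower bound. *)
have [t0|t0|t0] := ltgtP t 0.
- have tN : 0 < (- t)^-1 by rewrite invr_gt0 oppr_gt0.
  have : sup A <= dotp h ((- t)^-1 *: y).
    apply: ge_sup => //; apply: Aub; first exact: scalemx_sub.
    have -> : (- t)^-1 *: y - v = (- t)^-1 *: (y + t *: v).
      by rewrite scalerDr scalerA invrN mulNr mulVf ?lt_eqF // scaleN1r.
    by apply: coneZ => //; apply: ltW.
  rewrite dotpZr -(ler_nM2l t0) mulrA invrN mulrN divff ?lt_eqF //.
  by rewrite mulN1r => H; rewrite -lerBlDl sub0r.
- have tN : 0 < t^-1 by rewrite invr_gt0.
  have : - dotp h (t^-1 *: y) <= sup A.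
    apply: ub_le_sup => //; exists (t^-1 *: y) => //; split.
      exact: scalemx_sub.
    have -> : t^-1 *: y + v = t^-1 *: (y + t *: v).
      by rewrite scalerDr scalerA mulVf ?gt_eqF // scale1r.
    by apply: coneZ => //; apply: ltW.
  rewrite dotpZr -(ler_pM2l t0) mulrN mulrA divff ?gt_eqF // mul1r.
  by move=> H; rewrite -lerBlDl sub0r.
- by move: Kx; rewrite t0 scale0r mul0r !addr0; apply: hF.
Qed.

(** Induction on [l], one vector per step. The value at [s] is tracked because it certifies that the
    final form is nonzero. *)
Lemma riesz_extension (l : seq 'rV[R]_d) (F : 'M[R]_d) (s h : 'rV[R]_d) :
  (s <= F)%MS ->
  (forall v, v \in l ->
    (exists N, K (N *: s + v)) /\ (exists N, K (N *: s - v))) ->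
  (forall x, (x <= F)%MS -> K x -> 0 <= dotp h x) ->
  exists2 h', dotp h' s = dotp h s &
    exists2 G : 'M[R]_d, (forall v, v \in l -> (v <= G)%MS) &
      (F <= G)%MS /\ forall x, (x <= G)%MS -> K x -> 0 <= dotp h' x.
Proof.
elim: l F h => [|v l IH] F h sF lK hF.
  by exists h => //; exists F.
have [Nv1 Nv2] := lK v (mem_head v l).
have [h1 h1s h1F] := riesz_step sF Nv1 Nv2 hF.
have [|w wl|h2 h2s [G lG [FG hG]]] := IH (F + v)%MS h1 _ _ h1F.
- exact: submx_trans sF (addsmxSl _ _).
- by apply: lK; rewrite inE wl orbT.
exists h2; first by rewrite h2s.
exists G; last by split => //; apply: submx_trans FG; apply: addsmxSl.
move=> w; rewrite inE => /predU1P [->|/lG //].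
by apply: submx_trans FG; apply: addsmxSr.
Qed.

Lemma cone_eq_span m (A : 'M[R]_(m, d)) : K 0 ->
  (forall j, K (row j A)) ->
  (forall h, (forall x, K x -> 0 <= dotp h x) ->
    forall x, K x -> dotp h x = 0) ->
  (forall x, K x -> (x <= A)%MS) ->
  forall x, (x <= A)%MS -> K x.
Proof.
move=> K0 KA Kdisp KsubA.
pose s := \sum_j row j A.
have Ks : K s by apply: cone_sum.
have unitA x : (x <= A)%MS -> exists2 N, 0 <= N & K (N *: s + x).
  move=> /submxP [c ->]; exists (\sum_j `|c 0 j|); first exact: sumr_ge0.
  rewrite scaler_suml mulmx_sum_row -big_split; apply: cone_sum => // j /=.
  (* Both coefficients on the right are nonnegative, and [s - row j A] is the sum of the other rows,
     hence in [K]. *)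
  have -> : `|c 0 j| *: s + c 0 j *: row j A =
      `|c 0 j| *: (s - row j A) + (`|c 0 j| + c 0 j) *: row j A.
    by rewrite scalerBr scalerDl addrA subrK.
  apply: coneD; apply: coneZ => //.
    rewrite /s (bigD1 j) //= addrAC subrr add0r.
    by elim/big_ind: _.
  by rewrite -lerBlDr sub0r -normrN ler_norm.
have KNs : K (- s).
  apply: contrapT => KNs.
  have s0 : dotp s s != 0.
    by apply/eqP => /dotp_eq0 s0; apply: KNs; rewrite s0 oppr0.
  pose h0 := (dotp s s)^-1 *: s.
  have h0s : dotp h0 s = 1 by rewrite dotpZl mulVf.
  (* The extension starts from the line through [s]; [<<s>>] presents it as a square matrix. A
     negative multiple of [s] in [K] would rescale to [- s]. *)
  have h0K x : (x <= <<s>>)%MS -> K x -> 0 <= dotp h0 x.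
    rewrite genmxE => /sub_rVP [t ->] Kx; rewrite dotpZr h0s mulr1.
    rewrite leNgt; apply/negP => t0; apply: KNs.
    have -> : - s = (- t)^-1 *: (t *: s).
      by rewrite scalerA invrN mulNr mulVf ?lt_eqF // scaleN1r.
    by apply: coneZ => //; rewrite invr_ge0 oppr_ge0 ltW.
  have [||h hs [G AG [_ hG]]] :=
      @riesz_extension [seq row j A | j : 'I_m] <<s>>%MS s h0 _ _ h0K.
  - by rewrite genmxE.
  - move=> _ /mapP [j _ ->]; split.
      by have [N _ KN] := unitA _ (row_sub j A); exists N.
    have [|N _ KN] := unitA (- row j A); last by exists N.
    by rewrite eqmx_opp row_sub.
  (* The extended form is nonnegative on all of [K], so [Kdisp] makes it vanish at [s], where its
     value is 1. *)
  have: dotp h s = 0.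
    apply: Kdisp => // x Kx; apply: hG => //.
    apply: submx_trans (KsubA _ Kx) _; apply/row_subP => j; apply: AG.
    by apply/mapP; exists j; rewrite ?mem_enum.
  by rewrite hs h0s; apply/eqP; rewrite oner_eq0.
move=> x /unitA [N N0 KN].
have -> : x = (N *: s + x) + N *: (- s) by rewrite scalerN addrC addKr.
by apply: coneD => //; apply: coneZ.
Qed.

End Cone.

(** * Convex hulls, affine hulls and spanning families *)

Section Convex.
Context (R : realType) (d : nat).
Implicit Types (C E : set 'rV[R]_d).

Lemma convex_setP C : convex_set C <->
  forall x y t, 0 <= t -> t <= 1 -> C x -> C y -> C (t *: x + (1 - t) *: y).
Proof.
split=> [cC x y t t0 t1 Cx Cy|cC x y t].
  have := cC x y (Itv01 t0 t1); rewrite !inE => /(_ Cx Cy).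
  by [].
by rewrite !inE; apply: cC.
Qed.

Lemma convex_hull_convex E : convex_set (convex_hull E).
Proof.
apply/convex_setP => x y t t0 t1 Ex Ey X [cX EX].
exact: (convex_setP X).1 cX x y t t0 t1 (Ex X (conj cX EX)) (Ey X (conj cX EX)).
Qed.

Lemma dotp_ge0_convex_hull E h : (forall y, E y -> 0 <= dotp h y) ->
  forall y, convex_hull E y -> 0 <= dotp h y.
Proof.
move=> hE; apply: (@smallest_sub _ _ _ [set y | 0 <= dotp h y]) => //.
apply/convex_setP => x y t t0 t1 /= hx hy.
by rewrite dotpDr !dotpZr addr_ge0 // mulr_ge0 // subr_ge0.
Qed.

(** Reduces relative interior to the linear span: it is enough to find a ball whose trace on the
    span lies in the hull. *)
Lemma affine_hull_sub_span m E (A : 'M[R]_(m, d)) :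
  (forall y, E y -> (y <= A)%MS) ->
  forall y, affine_hull (convex_hull E) y -> (y <= A)%MS.
Proof.
move=> EA; apply: (@smallest_sub _ _ _ [set y : 'rV_d | (y <= A)%MS]).
  by move=> x y t xA yA /=; rewrite addmx_sub // scalemx_sub.
apply: smallest_sub => //.
by apply/convex_setP => x y t _ _ xA yA /=; rewrite addmx_sub // scalemx_sub.
Qed.

(** Induction on a bound [k] for the missing rank: a point of [E] outside the row space is appended
    as a new row and raises the rank. *)
Lemma exists_spanning_rows E : exists m (A : 'M[R]_(m, d)),
  (forall j, E (row j A)) /\ forall y, E y -> (y <= A)%MS.
Proof.
suff: forall k m (A : 'M[R]_(m, d)), (d <= \rank A + k)%N ->
    (forall j, E (row j A)) ->
    exists m (A : 'M[R]_(m, d)),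
      (forall j, E (row j A)) /\ forall y, E y -> (y <= A)%MS.
  move/(_ d 0%N 0); apply; last by case.
  by rewrite leq_addl.
elim=> [|k IH] m A rA EA.
  exists m, A; split => // y _; apply: submx_full.
  by rewrite /row_full eqn_leq rank_leq_col -(addn0 (\rank A)).
have [AE|] := pselect (forall y, E y -> (y <= A)%MS); first by exists m, A.
move=> /existsNP [y /not_implyP [Ey /negP yA]].
apply: (IH _ (col_mx A y)) => [|j].
  apply: leq_trans rA _; rewrite addnS -addSn leq_add2r.
  apply: rank_ltmx; rewrite ltmxE -!addsmxE addsmxSl /=.
  by rewrite addsmx_sub submx_refl.
case: (split_ordP j) => i ->; first by rewrite rowKu.
by rewrite rowKd [row i y](_ : _ = y) //; apply/rowP => l; rewrite !mxE ord1.
Qed.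

(** * Dilates of a convex set and the cone they form *)

Section Dilations.
Context (C : set 'rV[R]_d).
Hypothesis convexC : convex_set C.

Definition dilate (t : R) : set 'rV[R]_d := [set t *: z | z in C].

Lemma dilateD s t x y : 0 <= s -> 0 <= t ->
  dilate s x -> dilate t y -> dilate (s + t) (x + y).
Proof.
move=> s0 t0 [z1 Cz1 <-] [z2 Cz2 <-].
(* The convex weight [s / (s + t)] used below needs a nonzero sum; otherwise both points are 0. *)
have [st|st] := eqVneq (s + t) 0.
  move/eqP: (st); rewrite paddr_eq0 // => /andP [/eqP -> /eqP ->].
  by exists z1 => //; rewrite addr0 !scale0r addr0.
have st0 : 0 < s + t by rewrite lt_def st addr_ge0.
exists ((s / (s + t)) *: z1 + (1 - s / (s + t)) *: z2).
  apply: ((convex_setP C).1 convexC) => //; first by rewrite divr_ge0 // ltW.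
  by rewrite ler_pdivrMr // mul1r lerDl.
rewrite scalerDr !scalerA; congr (_ *: _ + _ *: _); first by field.
by field.
Qed.

Lemma dilate_le s t x : C 0 -> 0 <= s -> s <= t -> dilate s x -> dilate t x.
Proof.
move=> C0 s0 st sx; rewrite -(subrK s t) addrC -[x]addr0.
by apply: dilateD; rewrite ?subr_ge0 //; exists 0 => //; rewrite scaler0.
Qed.

Definition cone_hull : set 'rV[R]_d := [set x | exists2 t, 0 <= t & dilate t x].

Lemma cone_hullD x y : cone_hull x -> cone_hull y -> cone_hull (x + y).
Proof.
move=> [s s0 sx] [t t0 ty]; exists (s + t); first exact: addr_ge0.
exact: dilateD.
Qed.

Lemma cone_hullZ a x : 0 <= a -> cone_hull x -> cone_hull (a *: x).
Proof.
move=> a0 [t t0 [z Cz <-]]; exists (a * t); first exact: mulr_ge0.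
by exists z; rewrite ?scalerA.
Qed.

Lemma sub_cone_hull : C `<=` cone_hull.
Proof. by move=> x Cx; exists 1 => //; exists x; rewrite ?scale1r. Qed.

Lemma cone_hull0 : C !=set0 -> cone_hull 0.
Proof. by move=> [x Cx]; exists 0 => //; exists x; rewrite ?scale0r. Qed.

(** Adding [x] from the dilate by 1 and [- x] from the dilate by [t] writes 0 as [1 + t] times a
    point of [C]; since [1 + t] is positive, that point is 0. *)
Lemma zero_in_convex x : C x -> cone_hull (- x) -> C 0.
Proof.
move=> Cx [t t0 tx].
have [|z Cz] := @dilateD 1 t x (- x) ler01 t0 _ tx.
  by exists x; rewrite ?scale1r.
rewrite subrr => /eqP; rewrite scaler_eq0 => /orP [|/eqP <- //].
by rewrite gt_eqF // ltr_pwDl.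
Qed.

(* The ball is controlled through the coordinates of [v]: projecting the
   canonical basis onto the subspace gives vectors [b_i] in it with
   [v = \sum_i v_i b_i] for every [v] in the subspace. *)
Lemma ball_sub_convex m (A : 'M[R]_(m, d)) : C 0 ->
  (forall x, (x <= A)%MS -> cone_hull x) ->
  exists2 r, 0 < r & forall x, eucl_ball 0 r x -> (x <= A)%MS -> C x.
Proof.
move=> C0 AK; pose P := pinvmx A *m A.
have PA i : (row i P <= A)%MS by rewrite row_mul submxMl.
(* Dilates grow with the factor because [C] contains 0, so the sum of the factors for the two signs
   serves both. *)
have Tex i : exists t,
    [/\ 0 <= t, dilate t (row i P) & dilate t (- row i P)].
  have [t1 t10 Q1] := AK _ (PA i).
  have [|t2 t20 Q2] := AK (- row i P); first by rewrite eqmx_opp.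
  exists (t1 + t2); split; first exact: addr_ge0.
    by apply: dilate_le Q1; rewrite ?lerDl.
  by apply: dilate_le Q2; rewrite ?lerDr.
have [T TP] := fin_all_exists Tex.
have T0 : 0 <= \sum_i T i by apply: sumr_ge0 => i _; case: (TP i).
have T1 : 0 < 1 + \sum_i T i by apply: ltr_pwDl.
(* Each coordinate of [x] is below this radius in absolute value, so the total dilation factor is at
   most 1; the summand 1 keeps the denominator positive. *)
exists (1 + \sum_i T i)^-1 => [|x]; first by rewrite invr_gt0.
rewrite /eucl_ball /= subr0 => xr xA.
have xE : x = \sum_i x 0 i *: row i P.
  by rewrite -mulmx_sum_row mulmxA mulmxKpV.
have Qx : dilate (\sum_i `|x 0 i| * T i) x.
  rewrite {2}xE.
  have [] : 0 <= \sum_i `|x 0 i| * T i /\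
      dilate (\sum_i `|x 0 i| * T i) (\sum_i x 0 i *: row i P); last by [].
  apply: (big_ind2 (fun t y => 0 <= t /\ dilate t y)) => [|t1 y1 t2 y2|i _].
  - by split => //; exists 0 => //; rewrite scaler0.
  - by move=> [? ?] [? ?]; split; [apply: addr_ge0|apply: dilateD].
  have [Ti0 [z Cz Ez] [w Cw Ew]] := TP i.
  split; first exact: mulr_ge0.
  have [x0|x0] := leP 0 (x 0 i).
    by exists z => //; rewrite -scalerA Ez ger0_norm.
  by exists w => //; rewrite -scalerA Ew ltr0_norm // scalerN scaleNr opprK.
have : dilate 1 x.
  apply: dilate_le Qx => //.
    by apply: sumr_ge0 => i _; apply: mulr_ge0 => //; case: (TP i).
  apply: (@le_trans _ _ ((1 + \sum_i T i)^-1 * \sum_i T i)).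
    rewrite mulr_sumr; apply: ler_sum => i _.
    apply: ler_wpM2r; first by case: (TP i).
    exact: le_trans (coord_le_norm _ _) (ltW xr).
  by rewrite mulrC ler_pdivrMr // mul1r lerDr.
by case=> z Cz <-; rewrite scale1r.
Qed.

End Dilations.

(** * The two implications *)

Lemma disperse_relint E : E !=set0 -> disperse E -> relint (convex_hull E) 0.
Proof.
move=> [e Ee] dE; set C := convex_hull E.
have cC : convex_set C by apply: convex_hull_convex.
have EC : E `<=` C by apply: sub_gen_smallest.
have [m [A [EA AE]]] := exists_spanning_rows E.
have affA := affine_hull_sub_span AE.
have CA x : C x -> (x <= A)%MS by move=> Cx; apply: affA; apply: sub_gen_smallest.
have AK : forall x, (x <= A)%MS -> cone_hull C x.
  apply: cone_eq_span; [exact: cone_hullD|exact: cone_hullZ| | | |].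
  - by apply: cone_hull0; exists e; apply: EC.
  - by move=> j; apply: sub_cone_hull; apply: EC.
  (* A form nonnegative on the cone is nonnegative on [E], which excludes a negative infimum. So it
     vanishes on [E], and the hull bound for [h] and [- h] makes it vanish on [C]. *)
  - move=> h hK; have [h0|[/ereal_inf_lt [_ [y Ey <-]] + _]] := dE h.
      move=> _ [t _ [z Cz <-]]; rewrite dotpZr.
      suff -> : dotp h z = 0 by rewrite mulr0.
      apply/eqP; rewrite eq_le -oppr_ge0 -dotpNl; apply/andP.
      split; apply: (@dotp_ge0_convex_hull E) => // y Ey.
        by rewrite dotpNl h0 ?oppr0.
      by rewrite h0.
    by rewrite lte_fin ltNge hK //; apply: sub_cone_hull; apply: EC.
  - by move=> _ [t _ [z Cz <-]]; apply: scalemx_sub; apply: CA.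
have C0 : C 0.
  apply: (@zero_in_convex _ cC e); first exact: EC.
  by apply: AK; rewrite eqmx_opp; apply: AE.
split=> //; have [r r0 rC] := ball_sub_convex cC C0 AK.
by exists r => // x [xr /affA]; apply: rC.
Qed.

(** From 0 one can move slightly in the direction [- y] inside the hull. If [h] were nonnegative on
    [E], hence on the hull, its value at [y] would be both nonnegative and nonpositive. *)
Lemma relint_dotp_lt0 E h y : relint (convex_hull E) 0 ->
  E y -> dotp h y != 0 -> exists2 z, E z & dotp h z < 0.
Proof.
move=> [C0 [r r0 rC]] Ey hy; apply: contrapT => hE.
have {}hE z : E z -> 0 <= dotp h z.
  by move=> Ez; rewrite leNgt; apply/negP => hz; apply: hE; exists z.
have Cy : convex_hull E y by apply: sub_gen_smallest.
pose n := Num.sqrt (dotp y y).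
have n1 : 0 < 1 + n by apply: ltr_pwDl => //; apply: sqrtr_ge0.
(* Then [t * n] is less than [r], even when [n] is 0. *)
pose t := r / (1 + n).
have t0 : 0 < t by apply: divr_gt0.
have : convex_hull E (- t *: y).
  apply: rC; split.
    rewrite /eucl_ball /= subr0 norm_dotpZ normrN gtr0_norm // -/n.
    by rewrite mulrAC ltr_pdivrMr // ltr_pM2l // ltrDr.
  (* An affine combination of [y] and 0 with a weight outside the unit interval: it lies in the
     affine hull, and the ball condition brings it into the convex hull. *)
  have -> : - t *: y = - t *: y + (1 - - t) *: 0 by rewrite scaler0 addr0.
  by move=> X [aX CX]; apply: aX; apply: CX.
move=> /(dotp_ge0_convex_hull hE); rewrite dotpZr mulNr oppr_ge0 pmulr_rle0 //.
by move=> hy0; move: hy; rewrite eq_le hy0 hE.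
Qed.

Lemma relint_disperse E : relint (convex_hull E) 0 -> disperse E.
Proof.
move=> ri h; have [h0|] := pselect (forall y, E y -> dotp h y = 0).
  by left.
move=> /existsNP [y /not_implyP [Ey /eqP hy]]; right; split.
  have [z Ez hz] := relint_dotp_lt0 ri Ey hy.
  apply: (@le_lt_trans _ _ (dotp h z)%:E); last by rewrite lte_fin.
  by apply: ereal_inf_lbound; exists z.
have [|z Ez] := @relint_dotp_lt0 E (- h) y ri Ey; first by rewrite dotpNl oppr_eq0.
rewrite dotpNl oppr_lt0 => hz.
apply: (@lt_le_trans _ _ (dotp h z)%:E); first by rewrite lte_fin.
by apply: ereal_sup_ubound; exists z.
Qed.

End Convex.

Theorem proposition6 (R : realType) (d : nat) (E : set 'rV[R]_d)
    (E_nonempty : E !=set0) :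
  disperse E <-> relint (convex_hull E) 0.
Proof.
split; [exact: disperse_relint | exact: relint_disperse].
Qed.
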